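(* Let $\mathbb{K}$ be a field of characteristic different from $2$. Every $3$-dimensional nilpotent skew-symmetric $\mathbb{K}$-algebra is a Lie algebra, and it is isomorphic to the abelian $3$-dimensional Lie algebra or to the Heisenberg algebra $\mathfrak{h}_3$.
   Context: A skew-symmetric $\mathbb{K}$-algebra $A=(V,\mu)$ is a vector space $V$ with a bilinear map $\mu:V\times V\to V$ satisfying $\mu(X,Y)=-\mu(Y,X)$; no further identity is assumed. Set $\mathcal{C}^0(\mu)=A$, $\mathcal{C}^1(\mu)=\mu(A,A)$ and $\mathcal{C}^k(\mu)=\mu(\mathcal{C}^{k-1}(\mu),A)$ for $k\ge 2$ (linear spans of products). $A$ is nilpotent if $\mathcal{C}^k(\mu)=0$ for some $k$. The Heisenberg algebra $\mathfrak{h}_3$ has a basis $\{e_1,e_2,e_3\}$ with $\mu(e_1,e_2)=e_3$ and $\mu(e_1,e_3)=\mu(e_2,e_3)=0$. Algebras $(V,\mu)$, $(V',\mu')$ are isomorphic if there is a linear bijection $f:V\to V'$ with $f(\mu(X,Y))=\mu'(f(X),f(Y))$ for all $X,Y$. *)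

(* Defs.v *)
From HB Require Import structures.
From mathcomp Require Import all_boot all_order all_algebra.
From mathcomp Require Import ring.

Set Implicit Arguments.
Unset Strict Implicit.
Unset Printing Implicit Defensive.

Import GRing.Theory.
Local Open Scope ring_scope.

Section Products.

Variables (K : fieldType) (V : vectType K).
Implicit Types (mu : {bilinear V -> V -> V}) (U W X : {vspace V}).

Definition skew_symmetric mu := forall x y, mu x y = - mu y x.

(* Spanned by products of basis vectors only, as in [prodv];
   [mulv_subP] shows that it is the span of all the products. *)
Definition mulv mu U W : {vspace V} :=
  <<[seq mu u w | u <- vbasis U, w <- vbasis W]>>%VS.

Lemma memv_mulv mu U W u w : u \in U -> w \in W -> mu u w \in mulv mu U W.
Proof.
move=> /coord_vbasis-> /coord_vbasis->.
rewrite linear_sumlz; apply: memv_suml => i _.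
rewrite linear_sumr; apply: memv_suml => j _.
rewrite linearZl_LR linearZr_LR !memvZ // memv_span //.
by apply/allpairsP; exists ((vbasis U)`_i, (vbasis W)`_j); rewrite !memt_nth.
Qed.

Lemma mulv_subP mu U W X :
  reflect (forall u w, u \in U -> w \in W -> mu u w \in X)
          (mulv mu U W <= X)%VS.
Proof.
apply: (iffP idP) => [sX u w Uu Ww | sX].
  by apply: (subvP sX); apply: memv_mulv.
apply/span_subvP => _ /allpairsP[[u w] /= [Uu Ww ->]].
by apply: sX; apply: vbasis_mem.
Qed.

Fixpoint lower_central mu (k : nat) : {vspace V} :=
  if k is k'.+1 then mulv mu (lower_central mu k') fullv else fullv.

Definition nilpotent_alg mu := exists k, lower_central mu k = 0%VS.

(* The alternating law is the characteristic-free form of skew-symmetry. *)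
Definition is_lie_algebra mu :=
  (forall x, mu x x = 0) /\
  (forall x y z, mu x (mu y z) + mu y (mu z x) + mu z (mu x y) = 0).

End Products.

Definition isomorphic_alg (K : fieldType) (V W : vectType K)
    (mu : {bilinear V -> V -> V}) (nu : {bilinear W -> W -> W}) :=
  exists2 f : {linear V -> W},
    bijective f & forall x y, f (mu x y) = nu (f x) (f y).

Section Models.

Variable K : fieldType.
Implicit Types x y : 'rV[K]_3.

Definition abelian3 x y : 'rV[K]_3 := 0.

Lemma abelian3_bilinear : bilinear_for *:%R *:%R abelian3.
Proof. by split=> u a v w; rewrite /abelian3 /= scaler0 addr0. Qed.

HB.instance Definition _ :=
  bilinear_isBilinear.Build K _ _ _ _ _ abelian3 abelian3_bilinear.

(* The alternating bilinear map on the standard basis e_1 = delta_mx 0 0,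
   e_2 = delta_mx 0 1, e_3 = delta_mx 0 2 determined by the
   brackets in [heisenberg3_table]. *)
Definition heisenberg3 x y : 'rV[K]_3 :=
  (x 0 0 * y 0 1 - x 0 1 * y 0 0) *: delta_mx 0 2.

Lemma heisenberg3_bilinear : bilinear_for *:%R *:%R heisenberg3.
Proof.
by split=> u a v w; rewrite /heisenberg3 /= !mxE scalerA -scalerDl;
  congr (_ *: _); ring.
Qed.

HB.instance Definition _ :=
  bilinear_isBilinear.Build K _ _ _ _ _ heisenberg3 heisenberg3_bilinear.

Lemma heisenberg3_skew : skew_symmetric heisenberg3.
Proof.
by move=> x y; rewrite /heisenberg3 -scaleNr; congr (_ *: _); ring.
Qed.

Lemma heisenberg3_table :
  [/\ heisenberg3 (delta_mx 0 0) (delta_mx 0 1) = delta_mx 0 2,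
      heisenberg3 (delta_mx 0 0) (delta_mx 0 2) = 0
    & heisenberg3 (delta_mx 0 1) (delta_mx 0 2) = 0].
Proof.
by split; rewrite /heisenberg3 !mxE /= ?mulr0 ?mul0r ?mulr1 ?subr0 ?scale1r
  ?scale0r.
Qed.

End Models.

Arguments abelian3 : clear implicits.
Arguments heisenberg3 : clear implicits.

(* Main.v *)
(** The last nonzero term of the lower central series is central.  If the
    product is nonzero, pick a nonzero [z] in that term and complete it to a
    basis [x, y, z].  Since [z] is central, all products are multiples of
    [w = mu x y], and [z] is one of them; hence [w] is itself central and
    [x, y, w] is a basis with the Heisenberg table. *)

Require Import Defs.
From HB Require Import structures.
From mathcomp Require Import all_boot all_order all_algebra.
Local Open Scope ring_scope.

Import GRing.Theory.
Set Implicit Arguments.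
Unset Strict Implicit.
Unset Printing Implicit Defensive.

Section SkewAlgebras.

Variables (K : fieldType) (V : vectType K) (mu : {bilinear V -> V -> V}).

(** Skew-symmetry at equal arguments gives twice [mu x x] equal to zero, and 2 is invertible. *)
Lemma skew_alternating :
  2%N \notin [pchar K] -> skew_symmetric mu -> forall x, mu x x = 0.
Proof.
move=> charK skew x; have /eqP := skew x x.
rewrite -addr_eq0 -mulr2n -scaler_nat scaler_eq0 => /orP[|/eqP//].
by move=> two0; rewrite inE /= two0 in charK.
Qed.

Lemma central_in_derived :
  nilpotent_alg mu -> lower_central mu 1 != 0%VS ->
  exists z, [/\ z != 0, z \in lower_central mu 1 & forall v, mu z v = 0].
Proof.
move=> [k0 k0P] C1_neq0.
have exk : exists k, lower_central mu k == 0%VS by exists k0; apply/eqP.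
(* The least vanishing index is neither 0 nor 1, as the derived algebra is nonzero; so it is [k.+2],
   and term [k.+1] is the last nonzero one. *)
case: (ex_minnP exk) => -[|[|k]] /eqP Ck0 kmin.
- have C1_le : (lower_central mu 1 <= lower_central mu 0)%VS by apply: subvf.
  by rewrite Ck0 subv0 (negPf C1_neq0) in C1_le.
- by rewrite Ck0 eqxx in C1_neq0.
have Ck_neq0 : lower_central mu k.+1 != 0%VS.
  by apply/negP => /kmin; rewrite ltnn.
exists (vpick (lower_central mu k.+1)); split.
- by rewrite vpick0.
- have /subvP : (lower_central mu k.+1 <= lower_central mu 1)%VS.
    by apply/mulv_subP => u w _ _; apply: memv_mulv; rewrite memvf.
  by apply; apply: memv_pick.
move=> v; apply/eqP; rewrite -memv0 -Ck0.
by apply: memv_mulv; rewrite ?memv_pick ?memvf.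
Qed.

(** The isomorphism is the coordinate map in the basis [X], whose inverse is [comb];
    multiplicativity is thus checked on linear combinations only. *)
Lemma isomorphic_alg_basis n (X : n.-tuple V)
    (nu : {bilinear 'rV[K]_n -> 'rV[K]_n -> 'rV[K]_n}) :
  let comb (u : 'rV[K]_n) := \sum_(i < n) u 0 i *: X`_i in
  basis_of fullv X ->
  (forall u v, mu (comb u) (comb v) = comb (nu u v)) ->
  isomorphic_alg mu nu.
Proof.
move=> comb basX mult.
pose f v := \row_(i < n) coord X i v.
have f_linear : linear f.
  by move=> a u v; apply/rowP => i; rewrite !mxE linearP.
pose fL := HB.pack_for {linear V -> 'rV[K]_n} f
  (GRing.isLinear.Build K V 'rV[K]_n _ f f_linear).
have combK : cancel comb f.
  move=> u; apply/rowP => i; rewrite mxE.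
  by rewrite coord_sum_free ?(basis_free basX).
have fK : cancel f comb.
  move=> v; rewrite [RHS](coord_basis basX (memvf v)).
  by apply: eq_bigr => i _; rewrite mxE.
exists fL; first by exists comb.
by move=> x y /=; rewrite -{1}(fK x) -{1}(fK y) mult combK.
Qed.

Hypothesis alt_mu : forall x, mu x x = 0.
Hypothesis skew_mu : skew_symmetric mu.

(** By skew-symmetry [z] also annihilates from the right, so only the mixed terms in [x] and [y]
    survive; their coefficient is the 2 by 2 determinant of [heisenberg3]. *)
Lemma mul_lincomb3 x y z (a b c a' b' c' : K) :
  (forall v, mu z v = 0) ->
  mu (a *: x + b *: y + c *: z) (a' *: x + b' *: y + c' *: z)
    = (a * b' - b * a') *: mu x y.
Proof.
move=> zC; have zC' v : mu v z = 0 by rewrite skew_mu zC oppr0.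
rewrite !linearDl !linearDr /= !linearZl_LR !linearZr_LR /=.
rewrite !alt_mu !zC !zC' (skew_mu y x) !scaler0 !addr0 add0r.
by rewrite !scalerN !scalerA -scalerBl.
Qed.

Lemma heisenberg_basis :
  \dim {: V} = 3%N -> nilpotent_alg mu -> lower_central mu 1 != 0%VS ->
  exists x y, [/\ basis_of fullv [:: x; y; mu x y],
                  forall v, mu (mu x y) v = 0
                & forall u v, exists c, mu u v = c *: mu x y].
Proof.
move=> dimV nil C1_neq0.
have [z [z_neq0 zC1 zC]] := central_in_derived nil C1_neq0.
have dimzC : \dim (<[z]>^C)%VS = 2.
  by rewrite dimv_compl dimV dim_vline z_neq0.
have [x [y xyE]] : exists x y, vbasis (<[z]>^C)%VS = [:: x; y] :> seq V.
  have := size_tuple (vbasis (<[z]>^C)%VS); rewrite {2}dimzC.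
  by case: (tval _) => [|x [|y []]] // _; exists x, y.
have spanV v : exists a b c, v = a *: x + b *: y + c *: z.
  have : v \in (<[z]> + <[z]>^C)%VS by rewrite addv_complf memvf.
  case/memv_addP => _ /vlineP[c ->] [t].
  have /andP[/eqP <- _] := vbasisP (<[z]>^C)%VS; rewrite xyE span_cons span_seq1.
  case/memv_addP => _ /vlineP[a ->] [_ /vlineP[b ->] ->] ->.
  by exists a, b, c; rewrite addrC.
have mulE u v : exists c, mu u v = c *: mu x y.
  have [a [b [c ->]]] := spanV u; have [a' [b' [c' ->]]] := spanV v.
  by rewrite mul_lincomb3 //; eexists.
(* Membership of [z] in the line of [mu x y] follows from the inclusion of the whole derived algebra
   in that line, checked on products by [mulE]. *)
have [d zE] : exists d, z = d *: mu x y.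
  apply/vlineP; move: z zC1 {z_neq0 zC dimzC xyE spanV}; apply/subvP.
  by apply/mulv_subP => u v _ _; apply/vlineP.
have d_neq0 : d != 0 by apply: contraNneq z_neq0 => d0; rewrite zE d0 scale0r.
exists x, y; split => //; last first.
  by move=> v; apply: (scalerI d_neq0); rewrite -linearZl_LR -zE zC scaler0.
(* Three vectors in dimension 3 need only span, and [z] is a multiple of [mu x y]. *)
rewrite basisEdim dimV leqnn andbT; apply/subvP => v _.
have [a [b [c ->]]] := spanV v; rewrite zE.
by rewrite !memvD ?memvZ ?memv_span ?inE ?eqxx ?orbT.
Qed.

End SkewAlgebras.

Theorem proposition10 (K : fieldType) (V : vectType K)
    (mu : {bilinear V -> V -> V})
    (charK : 2%N \notin [pchar K])
    (dimV : \dim {: V} = 3%N)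
    (skew_mu : skew_symmetric mu)
    (nil_mu : nilpotent_alg mu) :
  is_lie_algebra mu /\
  (isomorphic_alg mu (abelian3 K) \/ isomorphic_alg mu (heisenberg3 K)).
Proof.
have alt := skew_alternating charK skew_mu.
have [C1_eq0 | C1_neq0] := eqVneq (lower_central mu 1) 0%VS.
  have mu0 x y : mu x y = 0.
    by apply/eqP; rewrite -memv0 -C1_eq0 memv_mulv ?memvf.
  split; first by split=> [//|x y z]; rewrite !mu0 !addr0.
  left; apply: (@isomorphic_alg_basis _ _ _ _ (tcast dimV (vbasis {: V}))).
    by rewrite val_tcast vbasisP.
  by move=> u v; rewrite mu0 big1 // => i _; rewrite mxE scale0r.
have [x [y [basX wC mulE]]] := heisenberg_basis alt skew_mu dimV nil_mu C1_neq0.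
split.
  (* Every product is a multiple of the central [mu x y], so each Jacobi term vanishes
     separately. *)
  have mul3 s t u : mu s (mu t u) = 0.
    by have [c ->] := mulE t u; rewrite linearZr_LR /= skew_mu wC oppr0 scaler0.
  by split=> [//|s t u]; rewrite !mul3 !addr0.
right; apply: (@isomorphic_alg_basis _ _ _ _ [tuple x; y; mu x y]) => // u v.
rewrite !big_ord_recl !big_ord0 /= !addr0 !addrA mul_lincomb3 //.
rewrite !mxE /= !mulr0 !scale0r !add0r mulr1.
(* Both sides agree up to the form of the ordinal indices: lifts from the sum against numerals in
   [heisenberg3]. *)
by congr ((_ * _ - _ * _) *: _); congr (_ _ _); apply: val_inj.
Qed.
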